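(* The linear system $$\begin{bmatrix} \dot{I}^m \\ \dot{U}^d \end{bmatrix}=\begin{bmatrix} -D^{-1}(E+YR) & D^{-1}Y \\ -\Psi L \Upsilon^{-1}+\Phi L \Upsilon^{-1} D^{-1}(E+YR) & -\Phi L \Upsilon^{-1}D^{-1}Y \end{bmatrix}\begin{bmatrix} I^m \\ U^d \end{bmatrix}$$ is semistable if the network is connected and one of the following conditions is satisfied. c1) There are positive scalars $\bar u$ and $\bar r$ such that $R_iI_i^{max}=\bar u$ and $\alpha_i=\beta_i\bar r$ for all $i\in\mathcal{N}$, there is a positive scalar $\nu_1$ such that $$\Upsilon+\bar uY\ge \nu_1 Y\Psi L,$$ and $\theta(Y\Psi L)$ exists and satisfies $$(\nu_1+\bar r)\,\theta^2(Y\Psi L)+\bar r>\tau_{max},$$ where $\tau_{max}=\max\{\tau_1,\dots,\tau_n\}$. c2) There are positive scalars $\tau,\bar r,\beta,\nu_2$ such that $D=\tau E$, $\Phi=\bar r\Psi$, $\Psi=\beta E$, $Y_s\ge 0$ with $Y_s\neq 0$ (so that $Y$ is invertible), $$Y^{-1}\Upsilon+R\Upsilon\ge \nu_2\beta L,$$ and $\theta(Y\Upsilon)$ exists and satisfies $$(\nu_2+\bar r)\,\theta^2(Y\Upsilon)+\nu_2+\bar r>\tau.$$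
   Context: Network. Let $\mathcal{N}=\{1,\dots,n\}$ be the set of generator nodes of a DC microgrid. Branch conductances $G_{kj}=G_{jk}\ge 0$ ($k\ne j$) and shunt conductances $G_{kk}\ge 0$ are given. The conductance matrix is $Y=[Y_{kj}]=Y_s+Y_c\in\mathbb{R}^{n\times n}$, with $Y_s=\mathrm{diag}(G_{11},\dots,G_{nn})$ and $Y_c$ the symmetric matrix with off-diagonal entries $-G_{kj}$ and diagonal entries $\sum_{j\ne k}G_{kj}$. The network is connected if the graph on $\mathcal{N}$ with an edge $\{k,j\}$ whenever $G_{kj}>0$ is connected. Information graph Laplacian. $L=(l_{ij})\in\mathbb{R}^{n\times n}$ has, for $i\neq j$, $l_{ij}=-1$ if $Y_{ij}\ne 0$ and $l_{ij}=0$ otherwise, and $l_{ii}=-\sum_{j\ne i}l_{ij}$. Parameters. $E$ is the identity matrix; $D=\mathrm{diag}(\tau_1,\dots,\tau_n)$ with filter time constants $\tau_k>0$; $R=\mathrm{diag}(R_1,\dots,R_n)$ with virtual resistances $R_k>0$; $\Upsilon=\mathrm{diag}(I_1^{max},\dots,I_n^{max})$ with maximum currents $I_k^{max}>0$; $\Phi=\mathrm{diag}(\alpha_1,\dots,\alpha_n)$, $\alpha_k>0$; $\Psi=\mathrm{diag}(\beta_1,\dots,\beta_n)$, $\beta_k>0$. $I^m\in\mathbb{R}^n$ is the vector of measured (filtered) currents and $U^d\in\mathbb{R}^n$ the vector of rated output voltages. Matrix notation. For a real square matrix $M$, $M_s=\frac{M+M^T}{2}$ and $M_k=\frac{M-M^T}{2}$.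 For real square, possibly non-symmetric, matrices, $A\ge B$ means that the symmetric part of $A-B$ is positive semidefinite. Define $$\theta(M)=\max_{\theta}\left\{\theta\ge 0\ \middle|\ \begin{bmatrix} M_s & 0\\ 0& M_s\end{bmatrix}\pm\theta\begin{bmatrix}0&M_k\\ M_k^T&0\end{bmatrix}\ge 0\right\}.$$ $\theta(M)$ exists when the set is nonempty, i.e. when $M_s\ge 0$; if $M$ is symmetric with $M\ge 0$, then $\theta(M)=+\infty$. Semistability. A linear system $\dot z=Az$ is semistable if $\lim_{t\to\infty}z(t)$ exists for every initial condition $z(0)$. *)

(* Defs.v *)
From HB Require Import structures.
From mathcomp Require Import all_boot all_order all_algebra.
From mathcomp Require Import all_classical all_reals all_analysis.

Set Implicit Arguments.
Unset Strict Implicit.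
Unset Printing Implicit Defensive.

Import Order.TTheory GRing.Theory Num.Theory.
Import numFieldNormedType.Exports.

Local Open Scope classical_set_scope.
Local Open Scope ring_scope.

Section Matrices.
Context {R : realType} {n : nat}.
Implicit Types A B M : 'M[R]_n.

Definition sym_part M : 'M[R]_n := 2^-1 *: (M + M^T).

Definition skew_part M : 'M[R]_n := 2^-1 *: (M - M^T).

Definition psd M : Prop :=
  M^T = M /\ forall x : 'cV[R]_n, 0 <= (x^T *m M *m x) 0 0.

Definition mxge A B : Prop := psd (sym_part (A - B)).

End Matrices.

Section Theta.
Context {R : realType} {n : nat}.
Implicit Types M : 'M[R]_n.

Definition theta_set M : set R :=
  [set t | 0 <= t /\
    let P := block_mx (sym_part M) 0 0 (sym_part M) in
    let Q := block_mx 0 (skew_part M) (skew_part M)^T 0 in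
    mxge (P + t *: Q) 0 /\ mxge (P - t *: Q) 0].

(* When nonempty, theta_set M is a closed interval with left end 0: either
   [0, t], whose supremum t is its maximum, or [0, +oo[, with supremum +oo.
   When it is empty, theta M takes the junk value -oo, so theta_exists must be
   required alongside any bound on theta M. *)
Definition theta M : \bar R := ereal_sup [set t%:E | t in theta_set M].

Definition theta_exists M : Prop := theta_set M !=set0.

End Theta.

Section Network.
Context {R : realType} {n : nat}.

Section Conductances.
(* G k j is a branch conductance for k != j; G k k is a shunt conductance. *)
Variable G : 'M[R]_n.

Definition conductances : Prop :=
  (forall k j, k != j -> G k j = G j k) /\ forall k j, 0 <= G k j.

Definition shunt_mx : 'M[R]_n := diag_mx (\row_k G k k).

Definition branch_mx : 'M[R]_n :=
  \matrix_(k, j) if k == j then \sum_(i | i != k) G k i else - G k j.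

Definition conductance_mx : 'M[R]_n := shunt_mx + branch_mx.

Definition connected_network : Prop :=
  forall k j : 'I_n, connect [rel a b | (a != b) && (0 < G a b)] k j.

End Conductances.

Definition info_weight (Y : 'M[R]_n) (i j : 'I_n) : R :=
  if Y i j != 0 then -1 else 0.

Definition info_laplacian (Y : 'M[R]_n) : 'M[R]_n :=
  \matrix_(i, j)
    if i == j then - \sum_(k | k != i) info_weight Y i k
    else info_weight Y i j.

(* D, Rv, Ups, Phi, Psi stand for the matrices D, R, Upsilon, Phi, Psi; the
   state is the column vector of I^m stacked on top of U^d. *)
Definition system_mx (Y L D Rv Ups Phi Psi : 'M[R]_n) : 'M[R]_(n + n) :=
  block_mx
    (- (invmx D *m (1%:M + Y *m Rv)))
    (invmx D *m Y)
    (- (Psi *m L *m invmx Ups)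
       + Phi *m L *m invmx Ups *m invmx D *m (1%:M + Y *m Rv))
    (- (Phi *m L *m invmx Ups *m invmx D *m Y)).

(* The base value 0 of the iterated maximum is harmless: it is only used with
   n > 0 and positive entries. *)
Definition max_entry (v : 'rV[R]_n) : R := \big[Num.max/0]_(i < n) v 0 i.

End Network.

Section Semistability.
Context {R : realType} {m : nat}.

(* z' = A z on [0, +oo[; only continuity is required at the end point 0. *)
Definition solves (A : 'M[R]_m) (z0 : 'cV[R]_m) (z : R -> 'cV[R]_m) : Prop :=
  [/\ z 0 = z0,
      {within `[0, +oo[, continuous z} &
      forall t : R, 0 < t -> is_derive t 1 z (A *m z t)].

Definition semistable (A : 'M[R]_m) : Prop :=
  forall (z0 : 'cV[R]_m) (z : R -> 'cV[R]_m), solves A z0 z ->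
    exists l : 'cV[R]_m, z t @[t --> +oo] --> l.

End Semistability.

(* Main.v *)
Require Import Defs.
From HB Require Import structures.
From mathcomp Require Import all_boot all_order all_algebra.
From mathcomp Require Import all_classical all_reals all_analysis.
From mathcomp Require Import complex.
From mathcomp Require Import ring lra.

Set Implicit Arguments.
Unset Strict Implicit.
Unset Printing Implicit Defensive.

Import Order.TTheory GRing.Theory Num.Theory.
Import numFieldNormedType.Exports.

Local Open Scope classical_set_scope.
Local Open Scope ring_scope.

(* In the per-unit currents x = Upsilon^-1 I^m the system reads
   D Upsilon x' = Y u - W x and u' = - Psi L x - Phi L x', where
   W = Upsilon + Y R Upsilon, so an eigenvalue l with eigenvector x solves
   l^2 D Upsilon x + l (W + Y Phi L) x + Y Psi L x = 0.  Multiplying on the left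
   by the conjugate transpose of x (under c2, after multiplication by Y^-1)
   gives a scalar quadratic equation in l with exactly one non-real quadratic
   form, that of Y Psi L under c1 and that of Y^-1 Upsilon under c2.  The number
   theta confines its values to a sector |Im| <= Re / theta, and the stated
   inequality is what excludes roots l <> 0 with Re l >= 0.  The eigenvalue 0 is
   semisimple: x0 = c 1 in a Jordan chain, and testing against the vector 1
   forces c = 0.  Finally, if A q(A) = 0 where q has all its roots in the open
   left half-plane, then z splits into q(A) z / q(0), which is constant, and a
   part annihilated by q(A), which tends to 0. *)

(** * Linear differential equations with stable spectrum *)

(** A Gronwall argument: once [h] stays below [c * (e / 2)], the function
    [expR (c * t) * (N t - e / 2)] is nonincreasing, so [N] exceeds [e / 2] by at most a multiple of
    [expR (- (c * t))]. *)
Lemma differential_ineq_cvg0 (R : realType) (c : R) (N N' h : R -> R) :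
  0 < c -> (forall t : R, 0 <= N t) ->
  (forall t : R, 0 < t -> is_derive t 1 N (N' t)) ->
  (forall t : R, 0 < t -> N' t <= - c * N t + h t) ->
  h t @[t --> +oo] --> 0 -> N t @[t --> +oo] --> 0.
Proof.
move=> c_gt0 N_ge0 dN leN' h0; apply/cvgr0Pnorm_lt => e e_gt0.
have ce_gt0 : 0 < c * (e / 2) by rewrite mulr_gt0 ?divr_gt0.
have hsmall : \forall t \near +oo, `|h t| < c * (e / 2).
  exact: (cvgr0Pnorm_lt _).1.
(* [T] is kept positive because the derivative of [N] is given on positive times only. *)
have [T T_gt0 hT] : exists2 T : R, 0 < T & forall t : R, T < t -> h t < c * (e / 2).
  case: hsmall => M [_ hM]; exists (Num.max M 1).
    by rewrite lt_max ltr01 orbT.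
  move=> t; rewrite gt_max => /andP[/hM Mt _].
  exact: le_lt_trans (ler_norm _) Mt.
pose g (t : R) := expR (c * t) * (N t - e / 2).
pose g' (t : R) := expR (c * t) * (c * (N t - e / 2) + N' t).
have dg (t : R) : 0 < t -> is_derive t 1 g (g' t).
  move=> t_gt0; have dNt := dN t t_gt0.
  have dE : is_derive t 1 (fun t : R => expR (c * t)) (expR (c * t) * c).
    have dc : is_derive t 1 ( *%R c) c.
      have /is_derive_eq := @is_deriveZ R R R id c t 1 1 (is_derive_id _ _).
      by apply; rewrite /GRing.scale /= mulr1.
    exact: (is_derive1_comp (is_derive_expR _) dc).
  have dC : is_derive t 1 (fun t : R => N t - e / 2) (N' t).
    by have /is_derive_eq := is_deriveB dNt (is_derive_cst (e / 2) t 1); apply; rewrite subr0.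
  have := is_deriveM dE dC.
  rewrite /GRing.scale /= => dM.
  by apply: (is_derive_eq (f := g) dM); rewrite /g'; ring.
have g_le (t : R) : T <= t -> g t <= g T.
  apply: (ler0_derive1_nincry (a := T)) => // [x|x|].
  - rewrite in_itv /= andbT => /(lt_trans T_gt0) x_gt0.
    by have [] := dg x x_gt0.
  - rewrite in_itv /= andbT => Tx.
    have x_gt0 := lt_trans T_gt0 Tx.
    have -> : g^`()%classic x = g' x.
      by rewrite derive1E; have dgx := dg x x_gt0; exact: derive_val.
    rewrite /g' pmulr_rle0 ?expR_gt0 //.
    have := leN' x x_gt0; have := hT x Tx; lra.
  - apply: derivable_within_continuous => x.
    rewrite in_itv /= andbT => /(lt_le_trans T_gt0) x_gt0.
    by have [] := dg x x_gt0.
have decay : g T * expR (- (c * t)) @[t --> +oo] --> 0.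
  have cty : c * t @[t --> +oo] --> +oo by apply: gt0_cvgMry => //; exact: cvg_id.
  have := cvg_comp _ _ cty (@cvgr_expR R) => Ect.
  rewrite -(mulr0 (g T)); exact: (cvgMr Ect).
have dsmall : \forall t \near +oo, `|g T * expR (- (c * t))| < e / 2.
  by apply: (cvgr0Pnorm_lt _).1 => //; rewrite divr_gt0.
near=> t.
have Tt : T <= t by near: t; exact: nbhs_pinfty_ge (num_real _).
have /(le_lt_trans (ler_norm _)) small : `|g T * expR (- (c * t))| < e / 2.
  by near: t.
have : N t - e / 2 <= g T * expR (- (c * t)).
  by rewrite expRN ler_pdivlMr ?expR_gt0 // mulrC g_le.
by rewrite ger0_norm //; lra.
Unshelve. all: by end_near.
Qed.

Lemma sqr_cvg0 (R : realType) (f : R -> R) :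
  f t ^+ 2 @[t --> +oo] --> 0 -> f t @[t --> +oo] --> 0.
Proof.
move=> f2; apply/cvgr0Pnorm_lt => e e_gt0.
have f2e : \forall t \near +oo, `|f t ^+ 2| < e ^+ 2.
  exact: (cvgr0Pnorm_lt _).1 f2 (e ^+ 2) (exprn_gt0 2 e_gt0).
near=> t.
have : `|f t ^+ 2| < e ^+ 2 by near: t.
by rewrite normrX ltr_pXn2r // ?nnegrE ?normr_ge0 // ltW.
Unshelve. all: by end_near.
Qed.

(** This is the complex scalar equation y' = (s + i w) y + input in real form, with y = f + i g. In
    the derivative of |y|^2 the terms in [w] cancel, and Young's inequality absorbs half of the
    damping 2 s |y|^2 to leave the input as a vanishing perturbation. *)
Lemma stable_pair_cvg0 (R : realType) (s w : R) (f g f1 g1 : R -> R) : s < 0 ->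
  (forall t : R, 0 < t -> is_derive t 1 f (s * f t - w * g t + f1 t)) ->
  (forall t : R, 0 < t -> is_derive t 1 g (w * f t + s * g t + g1 t)) ->
  f1 t @[t --> +oo] --> 0 -> g1 t @[t --> +oo] --> 0 ->
  f t @[t --> +oo] --> 0 /\ g t @[t --> +oo] --> 0.
Proof.
move=> s_lt0 df dg f10 g10.
pose N (t : R) := f t ^+ 2 + g t ^+ 2.
pose h (t : R) := (f1 t * f1 t + g1 t * g1 t) / - s.
have N0 : N t @[t --> +oo] --> 0.
  apply: (@differential_ineq_cvg0 R (- s) N
    (fun t : R => 2 * (f t * (s * f t - w * g t + f1 t)
                   + g t * (w * f t + s * g t + g1 t))) h).
  - by rewrite oppr_gt0.
  - by move=> t; rewrite addr_ge0 ?sqr_ge0.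
  - move=> t t_gt0; have dft := df t t_gt0; have dgt := dg t t_gt0.
    have := is_deriveD (is_deriveM dft dft) (is_deriveM dgt dgt).
    rewrite /GRing.scale /= => dM.
    have -> : N = f * f + g * g by apply/funext => x; rewrite /N !expr2.
    by apply: (is_derive_eq dM); ring.
  - move=> t _.
    have young (x y : R) : 2 * (x * y) <= - s * x ^+ 2 + y * y / - s.
      rewrite -subr_ge0.
      have -> : - s * x ^+ 2 + y * y / - s - 2 * (x * y) =
                - s * (x + y / s) ^+ 2 by field; rewrite lt_eqF.
      by rewrite mulr_ge0 ?sqr_ge0 // oppr_ge0 ltW.
    have := young (f t) (f1 t); have := young (g t) (g1 t).
    rewrite /N /h mulrDl !expr2; lra.
  - have -> : 0 = (0 * 0 + 0 * 0) / - s :> R by rewrite mulr0 addr0 mul0r.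
    by apply: cvgMl; apply: cvgD; apply: cvgM.
have sq_le (k : R -> R) : (forall t, k t ^+ 2 <= N t) -> k t @[t --> +oo] --> 0.
  move=> kN; apply: sqr_cvg0; apply: (squeeze_cvgr _ (@cvg_cst _ 0 _ _ _) N0).
  by near=> t; rewrite sqr_ge0 kN.
by split; apply: sq_le => t; rewrite /N ?lerDl ?lerDr sqr_ge0.
Unshelve. all: by end_near.
Qed.
Section Modes.
Context {R : realType} {m : nat}.
Variables (A : 'M[R]_m) (z0 : 'cV[R]_m) (z : R -> 'cV[R]_m).
Hypothesis Az : solves A z0 z.

Lemma is_derive_row_functional (u : 'rV[R]_m) (t : R) : 0 < t ->
  is_derive t 1 (fun t => (u *m z t) 0 0) ((u *m A *m z t) 0 0).
Proof.
case: Az => _ _ dz t_gt0; have [dvz vz] := dz t t_gt0.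
have dzj j : is_derive t 1 (fun t : R => z t j 0) ((A *m z t) j 0).
  apply: DeriveDef; first by move/derivable_mxP : dvz; apply.
  by move: vz; rewrite derive_mx // => /matrixP/(_ j 0); rewrite mxE.
have := @is_derive_sum _ _ _ _ (fun j => u 0 j *: (fun t : R => z t j 0 : R)) t 1 _
  (fun j => is_deriveZ (u 0 j) (dzj j)).
have -> : \sum_(j < m) u 0 j *: (fun t : R => z t j 0) = fun t => (u *m z t) 0 0.
  by apply/funext => x; rewrite fct_sumE mxE.
by move=> /is_derive_eq; apply; rewrite -mulmxA mxE.
Qed.

End Modes.

Local Notation toC := (map_mx (real_complex _)).

Lemma map_Re_mul (R : rcfType) m n p (M : 'M[R[i]]_(m, n)) (N : 'M[R]_(n, p)) :
  map_mx (@complex.Re R) (M *m toC N) = map_mx (@complex.Re R) M *m N.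
Proof.
apply/matrixP => i j; rewrite !mxE raddf_sum; apply: eq_bigr => k _.
by rewrite !mxE; case: (M i k) => a b /=; rewrite mulr0 subr0.
Qed.

Lemma map_Im_mul (R : rcfType) m n p (M : 'M[R[i]]_(m, n)) (N : 'M[R]_(n, p)) :
  map_mx (@complex.Im R) (M *m toC N) = map_mx (@complex.Im R) M *m N.
Proof.
apply/matrixP => i j; rewrite !mxE raddf_sum; apply: eq_bigr => k _.
by rewrite !mxE; case: (M i k) => a b /=; rewrite mulr0 add0r.
Qed.

(** By induction on the roots: the scalar y = xi z satisfies y' = l y + xi (A - l) z, and the row xi
    (A - l) is annihilated by the remaining factors, so the input tends to 0. *)
Lemma stable_modes_cvg0 (R : realType) m (A : 'M[R]_m.+1) z0 z (rs : seq R[i]) :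
  solves A z0 z -> (forall l, l \in rs -> complex.Re l < 0) ->
  forall xi : 'rV[R[i]]_m.+1,
    xi *m horner_mx (toC A) (\prod_(l <- rs) ('X - l%:P)) = 0 ->
  (map_mx (@complex.Re R) xi *m z t) 0 0 @[t --> +oo] --> 0 /\
  (map_mx (@complex.Im R) xi *m z t) 0 0 @[t --> +oo] --> 0.
Proof.
move=> Az; elim: rs => [|l rs IH] rs_lt0 xi.
  rewrite big_nil rmorph1 mulmx1 => ->.
  by rewrite !map_mx0; split; under eq_fun do rewrite mul0mx mxE; apply: cvg_cst.
rewrite big_cons rmorphM rmorphB /= horner_mx_X horner_mx_C mulmxA.
move=> xi0; have rs_lt0' k : k \in rs -> complex.Re k < 0.
  by move=> k_rs; apply: rs_lt0; rewrite inE k_rs orbT.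
have [fz gz] := IH rs_lt0' _ xi0.
have ReE : map_mx (@complex.Re R) xi *m A = complex.Re l *: map_mx (@complex.Re R) xi
    - complex.Im l *: map_mx (@complex.Im R) xi
    + map_mx (@complex.Re R) (xi *m (toC A - l%:M)).
  rewrite mulmxBr mul_mx_scalar -map_Re_mul; apply/matrixP => i j.
  rewrite !mxE raddfB /=; case: (xi i j) => a b; case: (l) => c d /=; ring.
have ImE : map_mx (@complex.Im R) xi *m A = complex.Im l *: map_mx (@complex.Re R) xi
    + complex.Re l *: map_mx (@complex.Im R) xi
    + map_mx (@complex.Im R) (xi *m (toC A - l%:M)).
  rewrite mulmxBr mul_mx_scalar -map_Im_mul; apply/matrixP => i j.
  rewrite !mxE raddfB /=; case: (xi i j) => a b; case: (l) => c d /=; ring.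
apply: (stable_pair_cvg0 (rs_lt0 l _) _ _ fz gz); rewrite ?mem_head // => t t_gt0;
  apply: (is_derive_eq (is_derive_row_functional Az _ t_gt0)).
  by rewrite ReE !mulmxDl mulNmx -!scalemxAl; do ?rewrite [LHS]mxE; do ?rewrite mxE.
by rewrite ImE !mulmxDl -!scalemxAl; do ?rewrite [LHS]mxE; do ?rewrite mxE.
Qed.
Lemma map_Re_mull (R : rcfType) m n p (N : 'M[R]_(m, n)) (M : 'M[R[i]]_(n, p)) :
  map_mx (@complex.Re R) (toC N *m M) = N *m map_mx (@complex.Re R) M.
Proof.
by apply: trmx_inj; rewrite map_trmx !trmx_mul !map_trmx map_Re_mul.
Qed.

Lemma map_Im_mull (R : rcfType) m n p (N : 'M[R]_(m, n)) (M : 'M[R[i]]_(n, p)) :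
  map_mx (@complex.Im R) (toC N *m M) = N *m map_mx (@complex.Im R) M.
Proof.
by apply: trmx_inj; rewrite map_trmx !trmx_mul !map_trmx map_Im_mul.
Qed.

Lemma map_Re_Im_eq0 (R : rcfType) m n (M : 'M[R[i]]_(m, n)) :
  map_mx (@complex.Re R) M = 0 -> map_mx (@complex.Im R) M = 0 -> M = 0.
Proof.
move=> /matrixP re0 /matrixP im0; apply/matrixP => i j.
move: (re0 i j) (im0 i j); rewrite !mxE.
by case: (M i j) => a b /= -> ->.
Qed.

(** Serves to pass from the row eigenvectors of [eigenvalue] to column eigenvectors. *)
Lemma char_poly_trmx (F : comNzRingType) n (A : 'M[F]_n) :
  char_poly A^T = char_poly A.
Proof.
rewrite /char_poly -det_tr; congr (\det _).
by apply/matrixP => i j; rewrite !mxE eq_sym.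
Qed.

Lemma mx_cvg (R : realType) m n (F : set_system R) (FF : Filter F)
    (M : R -> 'M[R]_(m, n)) (N : 'M[R]_(m, n)) :
  (forall i j, M t i j @[t --> F] --> N i j) -> M t @[t --> F] --> N.
Proof.
move=> MN; apply/cvgrPdist_le => /= e e_gt0; near=> t.
rewrite /Num.Def.normr /= mx_normrE (bigmax_le _ (ltW e_gt0)) //= => i _.
rewrite !mxE; move: i; near: t; apply: filter_forall => i /=.
exact: (cvgrPdist_le _ _).1 (MN i.1 i.2) _ e_gt0.
Unshelve. all: by end_near. Qed.

Lemma prod_XsubC_nz (F : fieldType) (r : seq F) :
  exists k, \prod_(l <- r) ('X - l%:P) =
            'X^k * \prod_(l <- [seq l <- r | l != 0]) ('X - l%:P).
Proof.
elim: r => [|l r [k IH]]; first by exists 0%N; rewrite !big_nil mulr1.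
rewrite big_cons IH /=; have [->|_] := eqVneq l 0.
  by exists k.+1; rewrite subr0 mulrA exprS.
by exists k; rewrite big_cons mulrCA.
Qed.

(* A complex eigenvector a + i b for the eigenvalue s + i w is encoded by the
   real pair (a, b). *)
Lemma semistable_spectrum (R : realType) m (A : 'M[R]_m.+1) :
  (forall (s w : R) (a b : 'cV[R]_m.+1),
      A *m a = s *: a - w *: b -> A *m b = w *: a + s *: b ->
      0 <= s -> (s != 0) || (w != 0) -> a = 0 /\ b = 0) ->
  (forall v : 'cV[R]_m.+1, A *m (A *m v) = 0 -> A *m v = 0) ->
  semistable A.
Proof.
move=> spec ss z0 z Az; set Ac := toC A.
have ssM p (M : 'M[R]_(m.+1, p)) : A *m (A *m M) = 0 -> A *m M = 0.
  move=> AAM; apply/matrixP => i j.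
  have /ss /colP /(_ i) : A *m (A *m col j M) = 0.
    by rewrite colE !mulmxA -(mulmxA A A M) AAM mul0mx.
  by rewrite colE mulmxA -colE !mxE.
have ssC p (M : 'M[R[i]]_(m.+1, p)) : Ac *m (Ac *m M) = 0 -> Ac *m M = 0.
  move=> AAM; apply: map_Re_Im_eq0.
    by rewrite map_Re_mull; apply: ssM; rewrite -!map_Re_mull AAM map_mx0.
  by rewrite map_Im_mull; apply: ssM; rewrite -!map_Im_mull AAM map_mx0.
have [r] := closed_field_poly_normal (char_poly Ac).
rewrite (monicP (char_poly_monic Ac)) scale1r => cpE.
have [k pE] := prod_XsubC_nz r.
set rs := [seq l <- r | l != 0] in pE.
set q := \prod_(l <- rs) _ in pE.
set Q := horner_mx Ac q.
(* Cayley-Hamilton gives A^k q(A) = 0, and semisimplicity of the eigenvalue 0 lowers the exponent to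
   one. *)
have AQ0 : Ac * Q = 0.
  have : Ac ^+ k * Q = 0.
    have := Cayley_Hamilton Ac.
    by rewrite cpE pE rmorphM rmorphXn /= horner_mx_X.
  elim: k {pE} => [|[|k] IH]; first by rewrite mul1r => ->; rewrite mulr0.
    by [].
  rewrite !exprS -!mulrA => /ssC AA; apply: IH.
  by rewrite exprS -mulrA.
have QA0 : Q * Ac = 0.
  by rewrite -AQ0 -[Ac in Q * Ac]horner_mx_X -[Ac in Ac * Q]horner_mx_X
             -!rmorphM mulrC.
have rs_lt0 l : l \in rs -> complex.Re l < 0.
  rewrite mem_filter => /andP[l0 lr].
  have : eigenvalue Ac^T l.
    by rewrite eigenvalue_root_char char_poly_trmx cpE root_prod_XsubC.
  case/eigenvalueP => v vA v0; rewrite ltNge; apply/negP => s_ge0.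
  have Av : Ac *m v^T = l *: v^T by rewrite -linearZ /= -vA trmx_mul trmxK.
  have [|||a0 b0] := spec (complex.Re l) (complex.Im l)
     (map_mx (@complex.Re R) v^T) (map_mx (@complex.Im R) v^T) _ _ s_ge0 _.
  - rewrite -map_Re_mull Av; apply/matrixP => i j; rewrite !mxE.
    by case: (v j i) => a b; case: (l) => c d.
  - rewrite -map_Im_mull Av; apply/matrixP => i j; rewrite !mxE.
    by case: (v j i) => a b; case: (l) => c d /=; rewrite addrC.
  - by move: l0; rewrite eq_complex negb_and.
  - by move/eqP: v0; apply; apply: trmx_inj; rewrite trmx0; apply: map_Re_Im_eq0.
have q0 : q.[0] != 0.
  by rewrite -rootE root_prod_XsubC mem_filter eqxx.
have zi_cvg i : exists l : R, z t i 0 @[t --> +oo] --> l.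
  pose e : 'rV[R[i]]_m.+1 := delta_mx 0 i.
  (* The i-th coordinate functional [e] splits as [eta] plus [e - eta]: [eta] kills A, so it is
     constant along the trajectory, and [e - eta] kills q(A), so it decays. *)
  pose eta := q.[0]^-1 *: (e *m Q).
  have etaA : map_mx (@complex.Re R) eta *m A = 0.
    rewrite -map_Re_mul -scalemxAl -mulmxA.
    by have -> : Q *m toC A = 0; [exact: QA0 | rewrite mulmx0 scaler0 map_mx0].
  (* Since q(0) - q is divisible by X, the matrix q(0) - q(A) ends with a factor A, which q(A)
     annihilates. *)
  have [p pq] : exists p, q.[0]%:P - q = p * 'X.
    have /factor_theorem [p] : root (q.[0]%:P - q) 0.
      by rewrite rootE hornerD hornerN hornerC subrr.
    by rewrite subr0 => ->; exists p.
  have xiQ : (e - eta) *m Q = 0.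
    rewrite /eta; have -> : e - q.[0]^-1 *: (e *m Q) =
        q.[0]^-1 *: (e *m (q.[0]%:M - Q)).
      by rewrite mulmxBr scalerBr mul_mx_scalar scalerA mulVf // scale1r.
    have -> : q.[0]%:M - Q = horner_mx Ac p * Ac.
      have := congr1 (horner_mx Ac) pq.
      by rewrite rmorphB rmorphM /= horner_mx_C horner_mx_X.
    by rewrite -scalemxAl -!mulmxA [Ac *m Q]AQ0 !mulmx0 scaler0.
  have [xi0 _] := stable_modes_cvg0 Az rs_lt0 xiQ.
  (* The constant is read off at time 1, inside the open half-line where the differential equation
     holds. *)
  exists ((map_mx (@complex.Re R) eta *m z 1) 0 0).
  have ziE (t : R) : z t i 0 = (map_mx (@complex.Re R) eta *m z t) 0 0
      + (map_mx (@complex.Re R) (e - eta) *m z t) 0 0.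
    have -> : map_mx (@complex.Re R) (e - eta) =
              delta_mx 0 i - map_mx (@complex.Re R) eta.
      apply/matrixP => a b; rewrite !mxE raddfB /=; congr (_ - _).
      by case: (_ && _).
    by rewrite mulmxBl -rowE [X in _ = _ + X]mxE [X in _ = _ + (X + _)]mxE
               [X in _ = _ + (_ + X)]mxE addrC subrK.
  have eta_cst (t : R) : 1 < t -> (map_mx (@complex.Re R) eta *m z t) 0 0 =
                            (map_mx (@complex.Re R) eta *m z 1) 0 0.
    move=> t_gt1.
    have d (x : R) : 0 < x ->
        is_derive x 1 (fun t : R => (map_mx (@complex.Re R) eta *m z t) 0 0) 0.
      move=> x_gt0; apply: (is_derive_eq (is_derive_row_functional Az _ x_gt0)).
      by rewrite etaA mul0mx mxE.
    have [x||c _] := MVT t_gt1 (df := cst 0)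
      (f := fun t : R => (map_mx (@complex.Re R) eta *m z t) 0 0).
    - by rewrite in_itv /= => /andP[x_gt1 _]; apply: d; rewrite (lt_trans ltr01).
    - apply: derivable_within_continuous => x.
      rewrite in_itv /= => /andP[/(lt_le_trans ltr01) x_gt0 _].
      by have [] := d x x_gt0.
    - by rewrite /cst mul0r => /eqP; rewrite subr_eq0 => /eqP.
  under eq_fun do rewrite ziE.
  rewrite -(addr0 ((map_mx (@complex.Re R) eta *m z 1) 0 0)); apply: cvgD => //.
  apply: cvg_near_cst; near=> t; apply: eta_cst.
  by near: t; exact: nbhs_pinfty_gt (num_real _).
have [l zl] := boolp.choice zi_cvg.
exists (\col_i l i); apply: mx_cvg => i j; rewrite mxE ord1.
exact: zl.
Unshelve. all: by end_near.
Qed.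
(** * Quadratic forms and the number theta *)

Definition bform (R : realType) n (M : 'M[R]_n) (x y : 'cV[R]_n) : R :=
  (x^T *m M *m y) 0 0.

Section BilinearForm.
Context {R : realType} {n : nat}.
Implicit Types (M N : 'M[R]_n) (x y z : 'cV[R]_n) (a : R).

Lemma bformE M x y : bform M x y = \sum_i x i 0 * (M *m y) i 0.
Proof. by rewrite /bform -mulmxA mxE; apply: eq_bigr => i _; rewrite mxE. Qed.

Lemma bformDr M x y z : bform M x (y + z) = bform M x y + bform M x z.
Proof. by rewrite /bform mulmxDr mxE. Qed.

Lemma bformBr M x y z : bform M x (y - z) = bform M x y - bform M x z.
Proof. by rewrite /bform mulmxBr !mxE. Qed.

Lemma bformZr M x a y : bform M x (a *: y) = a * bform M x y.
Proof. by rewrite /bform -scalemxAr mxE. Qed.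

Lemma bformDm M N x y : bform (M + N) x y = bform M x y + bform N x y.
Proof. by rewrite /bform mulmxDr mulmxDl mxE. Qed.

Lemma bformBm M N x y : bform (M - N) x y = bform M x y - bform N x y.
Proof. by rewrite /bform mulmxBr mulmxBl !mxE. Qed.

Lemma bformZm a M x y : bform (a *: M) x y = a * bform M x y.
Proof. by rewrite /bform -scalemxAr -scalemxAl mxE. Qed.

Lemma bform_tr M x y : bform M^T x y = bform M y x.
Proof.
have -> : bform M y x = (y^T *m M *m x)^T 0 0 by rewrite mxE.
by rewrite !trmx_mul trmxK mulmxA.
Qed.

Lemma bform_symC M x y : M^T = M -> bform M x y = bform M y x.
Proof. by move=> MT; rewrite -[in LHS]MT bform_tr. Qed.

Lemma bform_sym_part M x : bform (sym_part M) x x = bform M x x.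
Proof.
by rewrite /sym_part bformZm bformDm bform_tr; lra.
Qed.

Lemma mxge_bform M N x : mxge M N -> bform N x x <= bform M x x.
Proof.
by case=> _ /(_ x); rewrite -[(_ *m x) 0 0]/(bform _ x x) bform_sym_part bformBm subr_ge0.
Qed.

Lemma bform_diagE (v : 'rV[R]_n) x :
  bform (diag_mx v) x x = \sum_i v 0 i * x i 0 ^+ 2.
Proof.
rewrite bformE; apply: eq_bigr => i _.
by rewrite mul_diag_mx !mxE expr2 mulrCA.
Qed.

Lemma bform_diag_gt0 (v : 'rV[R]_n) x :
  (forall i, 0 < v 0 i) -> x != 0 -> 0 < bform (diag_mx v) x x.
Proof.
move=> v_gt0 x0; rewrite bform_diagE.
have [i xi] : exists i, x i 0 != 0.
  apply/existsP; apply: contraNT x0; rewrite negb_exists => /forallP x0.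
  by apply/eqP/colP => i; rewrite mxE; apply/eqP/negbNE.
rewrite (bigD1 i) //= ltr_pwDl //; first by rewrite mulr_gt0 ?exprn_even_gt0.
by apply: sumr_ge0 => j _; rewrite mulr_ge0 ?sqr_ge0 // ltW.
Qed.

End BilinearForm.

Section ThetaFacts.
Context {R : realType} {n : nat}.
Implicit Types (M : 'M[R]_n).

Lemma theta_set_ge0 M t : theta_set M t -> 0 <= t.
Proof. by case. Qed.

(** Both block inequalities are evaluated at the stacked vector (a, b). For x = a + i b, the
    right-hand side and the difference inside the absolute value are the real and imaginary parts of
    the Hermitian pairing of x with M x, so its values lie in a sector. *)
Lemma theta_set_bound M t (a b : 'cV[R]_n) : theta_set M t ->
  t * `|bform M a b - bform M b a| <= bform M a a + bform M b b.
Proof.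
case=> t_ge0 [/(mxge_bform (col_mx a b)) plus /(mxge_bform (col_mx a b)) minus].
have skewE : bform (block_mx 0 (skew_part M) (skew_part M)^T 0)
    (col_mx a b) (col_mx a b) = bform M a b - bform M b a.
  rewrite [LHS]/bform -mulmxA mul_block_col !mul0mx add0r addr0 tr_col_mx mul_row_col.
  rewrite !mulmxA mxE -[LHS]/(bform _ a b + bform _ b a) bform_tr.
  by rewrite /skew_part bformZm bformBm bform_tr; lra.
have symE : bform (block_mx (sym_part M) 0 0 (sym_part M))
    (col_mx a b) (col_mx a b) = bform M a a + bform M b b.
  rewrite [LHS]/bform -mulmxA mul_block_col !mul0mx add0r addr0 tr_col_mx mul_row_col.
  by rewrite !mulmxA mxE -[LHS]/(bform _ a a + bform _ b b) !bform_sym_part.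
have zero : bform 0 (col_mx a b) (col_mx a b) = 0.
  by rewrite /bform mulmx0 mul0mx mxE.
move: plus minus; rewrite bformDm bformBm bformZm skewE symE zero => plus minus.
by case: (ger0P (bform M a b - bform M b a)) => _; lra.
Qed.

(** Trades the extended real [theta M], possibly +oo, for a real member of [theta_set M]. If every
    member failed the strict bound, [theta M] would be at most the square root of (X - d) / c,
    contradicting the hypothesis. *)
Lemma theta_set_witness M (X c d : R) : 0 < c -> theta_exists M ->
  (X%:E < c%:E * theta M ^+ 2 + d%:E)%E ->
  exists2 t, theta_set M t & X < c * t ^+ 2 + d.
Proof.
move=> c_gt0 [t0 Mt0] Xlt; apply: contrapT => noT.
have le t : theta_set M t -> c * t ^+ 2 + d <= X.
  by move=> Mt; rewrite leNgt; apply/negP => Xt; apply: noT; exists t.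
have sq_le t : theta_set M t -> t ^+ 2 <= (X - d) / c.
  by move=> /le Mt; rewrite ler_pdivlMr // mulrC; lra.
have Xd_ge0 : 0 <= (X - d) / c := le_trans (sqr_ge0 t0) (sq_le _ Mt0).
have th_le : (theta M <= (Num.sqrt ((X - d) / c))%:E)%E.
  apply: ge_ereal_sup => _ [t Mt <-]; rewrite lee_fin.
  have [t_ge0 _] := Mt.
  by rewrite -(ger0_norm t_ge0) -sqrtr_sqr ler_sqrt // sq_le.
have th_ge : (0 <= theta M)%E.
  apply: (@le_trans _ _ t0%:E); first by rewrite lee_fin; case: Mt0.
  by apply: ereal_sup_ubound; exists t0.
move: th_le th_ge Xlt; case: (theta M) => [r||] //.
rewrite !lee_fin -EFin_expe -EFinM -EFinD lte_fin => r_le r_ge0.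
apply/negP; rewrite -leNgt.
have : r ^+ 2 <= (X - d) / c.
  by rewrite -[leRHS]sqr_sqrtr // ler_pXn2r // nnegrE ?sqrtr_ge0.
by rewrite ler_pdivlMr // mulrC; lra.
Qed.

End ThetaFacts.

(** * Network Laplacians *)

Section Laplacian.
Context {R : realType} {n : nat}.
Variable G : 'M[R]_n.
Hypothesis HG : conductances G.

Let Gsym k j : G k j = G j k.
Proof. by have [->//|kj] := eqVneq k j; apply: HG.1. Qed.

Lemma branch_mx_sym : (branch_mx G)^T = branch_mx G.
Proof.
apply/matrixP => k j; rewrite !mxE eq_sym.
by case: eqVneq => [->//|_]; rewrite Gsym.
Qed.

Lemma branch_mulE (x : 'cV[R]_n) k :
  (branch_mx G *m x) k 0 = \sum_j G k j * (x k 0 - x j 0).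
Proof.
rewrite mxE (bigD1 k) //= [RHS](bigD1 k) //= subrr mulr0 add0r mxE eqxx.
rewrite mulr_suml -big_split /=; apply: eq_bigr => j jk.
by rewrite mxE eq_sym (negPf jk) mulNr mulrBr.
Qed.

Lemma branch_mul_const c : branch_mx G *m const_mx c = 0 :> 'cV[R]_n.
Proof.
apply/colP => k; rewrite branch_mulE [RHS]mxE big1 // => j _.
by rewrite !mxE subrr mulr0.
Qed.

(** The Dirichlet energy of the network. The ordered double sum counts each branch twice, whence the
    factor 1/2; it is the average of two expressions exchanged by swapping the indices. *)
Lemma bform_branch (x : 'cV[R]_n) : bform (branch_mx G) x x =
  2^-1 * \sum_k \sum_j G k j * (x k 0 - x j 0) ^+ 2.
Proof.
have E1 : bform (branch_mx G) x x =
    \sum_k \sum_j G k j * (x k 0 * (x k 0 - x j 0)).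
  rewrite bformE; apply: eq_bigr => k _; rewrite branch_mulE mulr_sumr.
  by apply: eq_bigr => j _; rewrite mulrCA.
have E2 : bform (branch_mx G) x x =
    \sum_k \sum_j G k j * (x j 0 * (x j 0 - x k 0)).
  rewrite E1 exchange_big; apply: eq_bigr => k _; apply: eq_bigr => j _.
  by rewrite Gsym.
apply: (mulfI (x := 2)); first by rewrite pnatr_eq0.
rewrite mulrA mulfV ?pnatr_eq0 // mul1r mulr_natl mulr2n {1}E1 E2 -big_split.
apply: eq_bigr => k _; rewrite -big_split; apply: eq_bigr => j _ /=; ring.
Qed.

Lemma bform_branch_ge0 (x : 'cV[R]_n) : 0 <= bform (branch_mx G) x x.
Proof.
rewrite bform_branch mulr_ge0 ?invr_ge0 ?ler0n //.
by apply: sumr_ge0 => k _; apply: sumr_ge0 => j _;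
  rewrite mulr_ge0 ?sqr_ge0 // HG.2.
Qed.

(** Every term of the Dirichlet energy must vanish, so x takes equal values at the ends of each
    branch, hence along every path. *)
Lemma bform_branch_eq0 (x : 'cV[R]_n) : connected_network G ->
  bform (branch_mx G) x x = 0 -> exists c, x = const_mx c.
Proof.
move=> conn /eqP; rewrite bform_branch mulf_eq0 invr_eq0 pnatr_eq0 /= => /eqP s0.
have term_ge0 k j : 0 <= G k j * (x k 0 - x j 0) ^+ 2.
  by rewrite mulr_ge0 ?sqr_ge0 // HG.2.
have row_ge0 k : 0 <= \sum_j G k j * (x k 0 - x j 0) ^+ 2.
  by apply: sumr_ge0 => j _.
have term0 k j : G k j * (x k 0 - x j 0) ^+ 2 = 0.
  have rk := psumr_eq0P (fun k _ => row_ge0 k) s0 (i := k) isT.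
  exact: (psumr_eq0P (fun j _ => term_ge0 k j) rk (i := j) isT).
have edge k j : 0 < G k j -> x k 0 = x j 0.
  move=> Gkj; have /eqP := term0 k j.
  by rewrite mulf_eq0 gt_eqF //= sqrf_eq0 subr_eq0 => /eqP.
have cst k j : x k 0 = x j 0.
  have /connectP [p] := conn k j.
  elim: p k => [k _ ->//|i p IH k] /= /andP[/andP[_ /edge ->]].
  exact: IH.
case: n x cst {conn s0 term_ge0 row_ge0 term0 edge} => [|n'] x cst.
  by exists 0; apply/colP => -[].
by exists (x ord0 0); apply/colP => k; rewrite mxE.
Qed.

Lemma branch_mul_eq0 (x : 'cV[R]_n) : connected_network G ->
  branch_mx G *m x = 0 -> exists c, x = const_mx c.
Proof.
move=> conn Bx; apply: bform_branch_eq0 => //.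
by rewrite /bform -mulmxA Bx mulmx0 mxE.
Qed.

Lemma conductance_mx_sym : (conductance_mx G)^T = conductance_mx G.
Proof. by rewrite /conductance_mx linearD /= branch_mx_sym tr_diag_mx. Qed.

Lemma bform_shunt (x : 'cV[R]_n) :
  bform (shunt_mx G) x x = \sum_k G k k * x k 0 ^+ 2.
Proof. by rewrite bform_diagE; apply: eq_bigr => k _; rewrite mxE. Qed.

Lemma bform_shunt_ge0 (x : 'cV[R]_n) : 0 <= bform (shunt_mx G) x x.
Proof.
by rewrite bform_shunt sumr_ge0 // => k _; rewrite mulr_ge0 ?sqr_ge0 // HG.2.
Qed.

Lemma bform_conductance_ge0 (x : 'cV[R]_n) : 0 <= bform (conductance_mx G) x x.
Proof. by rewrite bformDm addr_ge0 ?bform_shunt_ge0 ?bform_branch_ge0. Qed.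

Lemma conductance_mul_eq0 (x : 'cV[R]_n) : connected_network G ->
  conductance_mx G *m x = 0 ->
  bform (shunt_mx G) x x = 0 /\ exists c, x = const_mx c.
Proof.
move=> conn Yx.
have := bform_shunt_ge0 x; have := bform_branch_ge0 x.
have : bform (conductance_mx G) x x = 0.
  by rewrite /bform -mulmxA Yx mulmx0 mxE.
rewrite bformDm => sum0 branch_ge0 shunt_ge0.
split; first by lra.
by apply: bform_branch_eq0 => //; lra.
Qed.

(** A kernel vector is constant by connectedness, and its shunt energy vanishes; a node with nonzero
    shunt conductance then forces the constant to be 0. *)
Lemma conductance_mx_unit : connected_network G -> shunt_mx G != 0 ->
  conductance_mx G \in unitmx.
Proof.
move=> conn shunt0; rewrite -unitmx_tr -row_free_unit -kermx_eq0.
apply/eqP/row_matrixP => i; rewrite row0.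
set u := row i _; have /(congr1 trmx) : u *m (conductance_mx G)^T = 0.
  by rewrite -row_mul mulmx_ker row0.
rewrite trmx_mul trmxK trmx0 => /(conductance_mul_eq0 conn) [shu [c uc]].
have [k Gkk] : exists k, G k k != 0.
  apply/existsP; apply: contraNT shunt0; rewrite negb_exists => /forallP Gk0.
  apply/eqP/matrixP => k j; rewrite !mxE.
  by have /negbNE/eqP -> := Gk0 k; rewrite mul0rn.
have /eqP : G k k * (u^T k 0) ^+ 2 = 0.
  move: shu; rewrite bform_shunt => sh0.
  by apply: (psumr_eq0P _ sh0) => // j _; rewrite mulr_ge0 ?sqr_ge0 // HG.2.
rewrite mulf_eq0 (negPf Gkk) /= sqrf_eq0 uc mxE => /eqP c0.
by apply: trmx_inj; rewrite uc c0 trmx0.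
Qed.

(** Unit conductances on the information graph: they make L itself a [branch_mx], so that the facts
    on network Laplacians apply to it. *)
Definition info_weights : 'M[R]_n :=
  \matrix_(i, j) (conductance_mx G i j != 0)%:R.

Lemma info_laplacianE :
  info_laplacian (conductance_mx G) = branch_mx info_weights.
Proof.
have wE i j : info_weight (conductance_mx G) i j = - info_weights i j.
  by rewrite /info_weight [in RHS]mxE; case: ifP; rewrite ?oppr0.
apply/matrixP => i j; rewrite [LHS]mxE [RHS]mxE wE -sumrN.
by case: eqP => // _; apply: eq_bigr => k _; rewrite wE opprK.
Qed.

Lemma conductances_info : conductances info_weights.
Proof.
split=> k j; last by rewrite mxE ler0n.
by move=> _; rewrite [LHS]mxE [RHS]mxE -{1}conductance_mx_sym [_^T _ _]mxE.
Qed.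

Lemma connected_info : connected_network G -> connected_network info_weights.
Proof.
move=> conn k j; apply: connect_sub (conn k j) => a b /= /andP[ab Gab].
apply: connect1; rewrite /= ab mxE ltr0n lt0b.
rewrite /conductance_mx mxE [shunt_mx _ _ _]mxE (negPf ab) mulr0n add0r mxE.
by rewrite (negPf ab) oppr_eq0 gt_eqF.
Qed.

End Laplacian.
(** * Root location of the scalar quadratic equations *)

Ltac nonneg := repeat first
  [ assumption | apply: ltW; assumption | apply: sqr_ge0
  | apply: mulr_ge0 | apply: addr_ge0 ].

(* m z^2 + (g + r k) z + k = 0 with z = s + i w and k = k1 + i k2. *)
Lemma sector_stiffness_stable (R : realFieldType) (s w m u g k1 k2 r nu t T : R) :
  0 < r -> 0 < nu -> 0 <= t -> 0 < m -> 0 < u -> u <= g -> nu * k1 <= g ->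
  t * `|k2| <= k1 -> m <= T * u -> T < (nu + r) * t ^+ 2 + r -> 0 <= s ->
  m * (s ^+ 2 - w ^+ 2) + s * (g + r * k1) - w * (r * k2) + k1 = 0 ->
  m * (2 * s * w) + w * (g + r * k1) + s * (r * k2) + k2 = 0 ->
  s = 0 /\ w = 0.
Proof.
move=> r0 nu0 t0 m0 u0 ug nuk tk mT Tlt s0 re im.
have k10 : 0 <= k1 by apply: le_trans tk; rewrite mulr_ge0.
set c := g + r * k1 in re im.
have rk10 : 0 <= r * k1 by rewrite mulr_ge0 // ltW.
have uc : u <= c by rewrite /c; lra.
have c0 : 0 < c by apply: lt_le_trans uc.
have [w0|wn0] := eqVneq w 0.
  split=> //; move: re; rewrite w0 => re.
  have sc0 : 0 <= s * c by rewrite mulr_ge0 // ltW.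
  have ms0 : 0 <= m * s ^+ 2 by rewrite mulr_ge0 ?sqr_ge0 // ltW.
  have /eqP : s * c = 0 by lra.
  by rewrite mulf_eq0 (gt_eqF c0) orbF => /eqP.
exfalso.
have w2 : 0 < w ^+ 2 by rewrite exprn_even_gt0.
pose p := 1 + r * s.
have rs0 : 0 <= r * s by rewrite mulr_ge0 // ltW.
have p1 : 1 <= p by rewrite /p; lra.
have p0 : 0 < p by lra.
have k2E : p * k2 = - (w * (2 * m * s + c)) by rewrite /p; lra.
(* The imaginary equation, solved for [p * k2], eliminates [k2] from the real equation multiplied by
   [p]. All terms on the left are nonnegative, so each is at most m w^2. *)
have balance : p * (m * s ^+ 2 + s * c + k1) + r * w ^+ 2 * (m * s + c) = m * w ^+ 2.
  have : p * (m * (s ^+ 2 - w ^+ 2) + s * c + k1) = w * r * (p * k2).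
    have -> : m * (s ^+ 2 - w ^+ 2) + s * c + k1 = w * r * k2 by lra.
    by rewrite mulrCA.
  by rewrite k2E /p => E; lra.
have ms0 : 0 <= m * s by rewrite mulr_ge0 // ltW.
have rest0 : 0 <= p * (m * s ^+ 2 + s * c) + r * w ^+ 2 * (m * s).
  by nonneg.
have pk10 : 0 <= p * k1 by rewrite mulr_ge0 // ltW.
have rcm : r * c <= m.
  rewrite -(ler_pM2r w2); lra.
(* Here r c <= m gives c^2 r s <= s c m, which the cross term 4 m s c dominates. *)
have sq_ge : c ^+ 2 * p <= (2 * m * s + c) ^+ 2.
  have : s * c * (r * c) <= s * c * m by rewrite ler_wpM2l // mulr_ge0 // ltW.
  have : 0 <= (m * s) ^+ 2 := sqr_ge0 _.
  have : 0 <= s * c * m by rewrite !mulr_ge0 // ltW.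
  by rewrite /p; lra.
have pk2 : w ^+ 2 * c ^+ 2 <= p * k2 ^+ 2.
  rewrite -(ler_pM2l p0).
  have -> : p * (p * k2 ^+ 2) = w ^+ 2 * (2 * m * s + c) ^+ 2.
    by rewrite mulrA -expr2 -exprMn k2E sqrrN exprMn.
  rewrite mulrCA -subr_ge0 -mulrBr mulr_ge0 ?(ltW w2) // subr_ge0 mulrC.
  exact: sq_ge.
have tk2 : t ^+ 2 * k2 ^+ 2 <= k1 ^+ 2.
  by rewrite -[k2 ^+ 2]real_normK ?num_real // -exprMn ler_pXn2r // nnegrE ?mulr_ge0.
have ck1 : (nu + r) * k1 ^+ 2 <= c * k1.
  by rewrite expr2 mulrA ler_wpM2r // /c; lra.
have nur : 0 < nu + r by rewrite addr_gt0.
(* Chains the lower bound on k2^2, the sector condition and (nu + r) k1 <= c. Put into [balance], it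
   gives ((nu + r) t^2 + r) c w^2 <= m w^2 <= T c w^2, against the bound on [T]. *)
have main : (nu + r) * t ^+ 2 * (w ^+ 2 * c) <= p * k1.
  rewrite -(ler_pM2r c0).
  have h1 : (nu + r) * t ^+ 2 * (w ^+ 2 * c ^+ 2) <= (nu + r) * t ^+ 2 * (p * k2 ^+ 2).
    by rewrite ler_wpM2l // mulr_ge0 ?sqr_ge0 // ltW.
  have h2 : (nu + r) * p * (t ^+ 2 * k2 ^+ 2) <= (nu + r) * p * k1 ^+ 2.
    by rewrite ler_wpM2l // mulr_ge0 // ltW.
  have h3 : p * ((nu + r) * k1 ^+ 2) <= p * (c * k1) by rewrite ler_wpM2l // ltW.
  lra.
have T0 : 0 < T by rewrite -(pmulr_lgt0 _ u0); apply: lt_le_trans mT.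
have wc : T * (w ^+ 2 * c) < ((nu + r) * t ^+ 2 + r) * (w ^+ 2 * c).
  by rewrite ltr_pM2r // mulr_gt0.
have Tu : T * u * w ^+ 2 <= T * c * w ^+ 2.
  by rewrite ler_wpM2r ?(ltW w2) // ler_wpM2l // ltW.
have mTw : m * w ^+ 2 <= T * u * w ^+ 2 by rewrite ler_wpM2r // ltW.
lra.
Qed.

(* T p z^2 + (p + rho + r l) z + l = 0 with z = s + i w and p = p1 + i p2. *)
Lemma sector_inertia_stable (R : realFieldType) (s w p1 p2 rho l r nu t T : R) :
  0 < r -> 0 < nu -> 0 <= t -> 0 < T -> 0 < rho -> 0 <= l ->
  nu * l <= p1 + rho -> t * `|p2| <= p1 ->
  T < (nu + r) * t ^+ 2 + (nu + r) -> 0 <= s ->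
  T * (p1 * (s ^+ 2 - w ^+ 2) - p2 * (2 * s * w)) + (p1 + rho + r * l) * s
    - p2 * w + l = 0 ->
  T * (p2 * (s ^+ 2 - w ^+ 2) + p1 * (2 * s * w)) + (p1 + rho + r * l) * w
    + p2 * s = 0 ->
  s = 0 /\ w = 0.
Proof.
move=> r0 nu0 t0 T0 rho0 l0 nul tp Tlt s0 re im.
have [sw0|swn0] := eqVneq (s ^+ 2 + w ^+ 2) 0.
  by move/eqP: sw0; rewrite paddr_eq0 ?sqr_ge0 // !sqrf_eq0 => /andP[/eqP -> /eqP ->].
exfalso.
have N0 : 0 < s ^+ 2 + w ^+ 2 by rewrite lt_def swn0 addr_ge0 ?sqr_ge0.
have p10 : 0 <= p1 by apply: le_trans tp; rewrite mulr_ge0.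
(* Dividing the equation by z turns l / z into l' times the conjugate of z: T p z + p + q + l'
   conj(z) = 0, with real part [reA] and imaginary part [imB]. *)
pose l' := l / (s ^+ 2 + w ^+ 2).
have lE : l = l' * (s ^+ 2 + w ^+ 2) by rewrite /l' divfK.
have l'0 : 0 <= l' by rewrite /l' divr_ge0 // ltW.
set q := rho + r * l.
have rl0 : 0 <= r * l by rewrite mulr_ge0 // ltW.
have reA : T * (p1 * s - p2 * w) + p1 + q + l' * s = 0.
  apply: (mulfI swn0); rewrite mulr0.
  have := congr2 (fun x y => s * x + w * y) re im.
  by rewrite !mulr0 addr0 => <-; rewrite /q lE; ring.
have imB : T * (p1 * w + p2 * s) + p2 - l' * w = 0.
  apply: (mulfI swn0); rewrite mulr0.
  have := congr2 (fun x y => s * x - w * y) im re.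
  by rewrite !mulr0 subr0 => <-; rewrite /q lE; ring.
(* The real part bounds this quantity below by p1 + q > 0, which excludes w = 0 and p2 = 0. *)
pose Z := T * (p2 * w).
have Ts0 : 0 <= T * s by rewrite mulr_ge0 // ltW.
have ls0 : 0 <= l' * s by rewrite mulr_ge0.
have ZE : Z = p1 * (T * s) + p1 + q + l' * s by rewrite /Z; lra.
have pTs : 0 <= p1 * (T * s) by rewrite mulr_ge0.
have Zge : p1 + q <= Z by lra.
have Z0 : 0 < Z by rewrite /q in Zge; lra.
have ZTs : 0 <= Z * (T * s) by rewrite mulr_ge0 // ltW.
have Tls : 0 <= T * (l' * s ^+ 2) by nonneg.
(* The imaginary part multiplied by T w, with l' w^2 = l - l' s^2. *)
have Tl : p1 * (T * w) ^+ 2 + Z <= T * l.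
  have : T * w * (T * (p1 * w + p2 * s) + p2 - l' * w) = 0 by rewrite imB mulr0.
  by rewrite lE; rewrite /Z in ZTs *; lra.
(* The squared sector condition bounds t^2 Z^2 by p1^2 (T w)^2, and one factor is cancelled using p1
   <= Z. *)
have sector : t ^+ 2 * Z <= p1 * (T * w) ^+ 2.
  have tp2 : t ^+ 2 * p2 ^+ 2 <= p1 ^+ 2.
    by rewrite -[p2 ^+ 2]real_normK ?num_real // -exprMn ler_pXn2r // nnegrE ?mulr_ge0.
  have tZ : t ^+ 2 * Z ^+ 2 <= p1 ^+ 2 * (T * w) ^+ 2.
    have -> : t ^+ 2 * Z ^+ 2 = t ^+ 2 * p2 ^+ 2 * (T * w) ^+ 2 by rewrite /Z; ring.
    by rewrite ler_wpM2r // sqr_ge0.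
  have [p1z|p1nz] := eqVneq p1 0.
    move: tZ; rewrite p1z expr0n /= !mul0r => tZ.
    by rewrite -(ler_pM2r Z0) mul0r -mulrA -expr2.
  have p1p : 0 < p1 by rewrite lt_def p1nz.
  have p1Z : p1 <= Z by rewrite /q in Zge; lra.
  rewrite -(ler_pM2l p1p); have : t ^+ 2 * (p1 * Z) <= t ^+ 2 * (Z * Z).
    by rewrite ler_wpM2l ?sqr_ge0 // ler_wpM2r // ltW.
  lra.
(* Together, (t^2 + 1)(nu + r) l <= (t^2 + 1) Z <= T l, which contradicts the bound on [T] if l > 0;
   if l = 0, it contradicts Z > 0. *)
have Zl : (nu + r) * l <= Z by rewrite /q in Zge; lra.
have [lz|lnz] := eqVneq l 0.
  have : 0 <= t ^+ 2 * Z by rewrite mulr_ge0 ?sqr_ge0 // ltW.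
  by rewrite lz mulr0 in Tl; lra.
have lp : 0 < l by rewrite lt_def lnz.
have : (t ^+ 2 + 1) * ((nu + r) * l) <= (t ^+ 2 + 1) * Z.
  by rewrite ler_wpM2l // addr_ge0 ?sqr_ge0.
have : T * l < ((nu + r) * t ^+ 2 + (nu + r)) * l by rewrite ltr_pM2r.
lra.
Qed.
Lemma diag_mx_unit (F : fieldType) n (v : 'rV[F]_n) :
  (forall i, v 0 i != 0) -> diag_mx v \in unitmx.
Proof.
move=> v0; rewrite unitmxE det_diag unitfE.
by apply/prodf_neq0 => i _; exact: v0.
Qed.

(** The equations say (s + i w)(p + i q) = 0; multiply by the conjugate s - i w. *)
Lemma rotation_eq0 (R : realFieldType) (V : lmodType R) (s w : R) (p q : V) :
  (s != 0) || (w != 0) -> s *: p - w *: q = 0 -> w *: p + s *: q = 0 ->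
  p = 0 /\ q = 0.
Proof.
move=> sw e1 e2.
have sw2 : s ^+ 2 + w ^+ 2 != 0.
  by rewrite paddr_eq0 ?sqr_ge0 // !sqrf_eq0 negb_and.
split; apply: (scalerI sw2); rewrite scaler0.
  have := congr2 (fun x y => s *: x + w *: y) e1 e2.
  rewrite !scaler0 addr0 => <-; rewrite scalerBr scalerDr !scalerA addrA.
  by rewrite [w * s]mulrC addrAC addrNK addrC -!expr2 -scalerDl addrC.
have := congr2 (fun x y => s *: y - w *: x) e1 e2.
rewrite !scaler0 subr0 => <-; rewrite scalerBr scalerDr !scalerA opprB addrA.
by rewrite [w * s]mulrC addrAC -!expr2 [X in X - _]addrC addrK scalerDl addrC.
Qed.

(** * Reduction to the second-order pencil *)

Section Reduction.
Context {R : realType} {n' : nat}.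
Local Notation n := n'.+1.
Variable G : 'M[R]_n.
Hypothesis HG : conductances G.
Variables tau r Imax alpha beta : 'rV[R]_n.
Hypotheses (tau_gt0 : forall i, 0 < tau 0 i)
  (Imax_gt0 : forall i, 0 < Imax 0 i) (beta_gt0 : forall i, 0 < beta 0 i).

Let Y := conductance_mx G.
Let L := info_laplacian Y.
Let D := diag_mx tau.
Let Rv := diag_mx r.
Let Ups := diag_mx Imax.
Let Phi := diag_mx alpha.
Let Psi := diag_mx beta.
Let W := Ups + Y *m Rv *m Ups.
Let A := system_mx Y L D Rv Ups Phi Psi.

Let D_unit : D \in unitmx.
Proof. by apply: diag_mx_unit => i; rewrite gt_eqF. Qed.

Let Ups_unit : Ups \in unitmx.
Proof. by apply: diag_mx_unit => i; rewrite gt_eqF. Qed.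

Let Psi_unit : Psi \in unitmx.
Proof. by apply: diag_mx_unit => i; rewrite gt_eqF. Qed.

(* The state in per-unit currents x = Upsilon^-1 I^m. *)
Let X (v : 'cV[R]_(n + n)) : 'cV[R]_n := invmx Ups *m usubmx v.

Let UpsX v : Ups *m X v = usubmx v.
Proof. by rewrite /X mulmxA mulmxV // mul1mx. Qed.

Let WX v : W *m X v = (1%:M + Y *m Rv) *m usubmx v.
Proof.
rewrite [LHS]mulmxDl [RHS]mulmxDl mul1mx -UpsX; congr (_ + _).
by rewrite !mulmxA.
Qed.

(** The lower block row contains - Phi L Upsilon^-1 times the upper one, so the voltage part of [v1]
    is expressed through its own current part. *)
Lemma system_mulE (v v1 : 'cV[R]_(n + n)) : A *m v = v1 ->
  D *m Ups *m X v1 = Y *m dsubmx v - W *m X v /\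
  dsubmx v1 = - (Psi *m L *m X v + Phi *m L *m X v1).
Proof.
rewrite -[in A *m v](vsubmxK v) /A /system_mx mul_block_col => <-.
rewrite -[D *m _ *m _]mulmxA UpsX WX.
rewrite /X col_mxKu col_mxKd; set I := usubmx v; set U := dsubmx v.
have I1E : - (invmx D *m (1%:M + Y *m Rv)) *m I + invmx D *m Y *m U =
    invmx D *m (Y *m U - (1%:M + Y *m Rv) *m I).
  by rewrite mulmxBr !mulmxA mulNmx addrC.
split.
  by rewrite I1E mulmxA mulmxV // mul1mx.
rewrite I1E [(- _ + _) *m I]mulmxDl !mulNmx !(mulmxA (Phi *m L)) mulmxBr.
by rewrite mulmxBr opprD opprB addrA !mulmxA.
Qed.

(** The first condition concerns eigenvectors: the upper row multiplied by the eigenvalue, with the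
    voltages eliminated through the lower row, is the quadratic pencil, split here into real and
    imaginary parts. The second concerns Jordan chains at 0. *)
Lemma system_semistable :
  connected_network G ->
  (forall (s w : R) (a b : 'cV[R]_n),
      let a1 := s *: a - w *: b in let b1 := w *: a + s *: b in
      D *m Ups *m (s *: a1 - w *: b1) + W *m a1
        + Y *m (Psi *m L *m a + Phi *m L *m a1) = 0 ->
      D *m Ups *m (w *: a1 + s *: b1) + W *m b1
        + Y *m (Psi *m L *m b + Phi *m L *m b1) = 0 ->
      0 <= s -> (a != 0) || (b != 0) -> s = 0 /\ w = 0) ->
  (forall c (x : 'cV[R]_n),
      W *m const_mx c + Y *m (Psi *m L *m x) = 0 -> c = 0) ->
  semistable A.
Proof.
move=> conn stable simple.
have XB (p q : R) (v v' : 'cV[R]_(n + n)) :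
    X (p *: v - q *: v') = p *: X v - q *: X v'.
  by rewrite /X !(linearB, linearZ).
have XD (p q : R) (v v' : 'cV[R]_(n + n)) :
    X (p *: v + q *: v') = p *: X v + q *: X v'.
  by rewrite /X !(linearD, linearZ).
have dB (p q : R) (v v' : 'cV[R]_(n + n)) :
    dsubmx (p *: v - q *: v') = p *: dsubmx v - q *: dsubmx v'.
  by rewrite linearB !linearZ.
have dD (p q : R) (v v' : 'cV[R]_(n + n)) :
    dsubmx (p *: v + q *: v') = p *: dsubmx v + q *: dsubmx v'.
  by rewrite linearD !linearZ.
have v0 (v : 'cV[R]_(n + n)) : X v = 0 -> dsubmx v = 0 -> v = 0.
  by move=> Xv dv; rewrite -[v]vsubmxK -UpsX Xv mulmx0 dv col_mx0.
have cancel (p q : R) (p1 p2 p3 p4 : 'cV[R]_n) :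
    p *: (p1 - p2) - q *: (p3 - p4) + (p *: p2 - q *: p4)
      - (p *: p1 - q *: p3) = 0.
  by apply/colP => i; rewrite !mxE; ring.
have cancelD (p q : R) (p1 p2 p3 p4 : 'cV[R]_n) :
    p *: (p1 - p2) + q *: (p3 - p4) + (p *: p2 + q *: p4)
      - (p *: p1 + q *: p3) = 0.
  by apply/colP => i; rewrite !mxE; ring.
apply: semistable_spectrum => [s w a b Aa Ab s_ge0 sw|v AAv].
  have [topa bota] := system_mulE Aa; have [topb botb] := system_mulE Ab.
  rewrite XB in topa bota; rewrite XD in topb botb.
  rewrite dB in bota; rewrite dD in botb.
  have [/orP nz|/norP[/negPn/eqP Xa0 /negPn/eqP Xb0]] :=
      boolP ((X a != 0) || (X b != 0)).
    have [] := stable s w (X a) (X b) _ _ s_ge0 _.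
    - rewrite mulmxBr -!scalemxAr topa topb -[Psi *m _ *m _ + _]opprK -bota.
      by rewrite mulmxN !mulmxBr -!scalemxAr cancel.
    - rewrite (mulmxDr (D *m Ups)) -2!(scalemxAr _ (D *m Ups)) topa topb
        -[Psi *m _ *m _ + _]opprK -botb.
      rewrite mulmxN (mulmxDr W) (mulmxDr Y) -2!(scalemxAr _ W) -2!(scalemxAr _ Y).
      exact: cancelD.
    - exact/orP.
    - by move=> s0 w0; move: sw; rewrite s0 w0 eqxx.
  (* Without currents the lower row says that the eigenvalue times the voltage vector is 0. *)
  rewrite Xa0 Xb0 !scaler0 !(subr0, addr0) !mulmx0 addr0 oppr0 in bota botb.
  have [da0 db0] := rotation_eq0 sw bota botb.
  by split; exact: v0.
(* The lower row of A v1 = 0 gives L x1 = 0, so x1 is a constant vector; then u1 = - Psi L x, and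
   the upper row is the equation of the second condition. *)
set v1 := A *m v in AAv *.
have [_ u1E] := system_mulE (erefl v1).
have [] := system_mulE AAv.
have X0 : X 0 = 0 by rewrite /X linear0 mulmx0.
rewrite X0 !mulmx0 addr0 linear0 => WYu /esym/eqP; rewrite oppr_eq0 -mulmxA => /eqP PLx.
have LE : L = branch_mx (info_weights G) := info_laplacianE G.
have HW := conductances_info HG.
have Lx1 : L *m X v1 = 0.
  by rewrite -[LHS]mul1mx -(mulVmx Psi_unit) -mulmxA PLx mulmx0.
have [c x1E] : exists c, X v1 = const_mx c.
  by apply: (branch_mul_eq0 HW); [exact: connected_info | rewrite -LE].
rewrite -[Phi *m L *m _]mulmxA Lx1 mulmx0 addr0 in u1E.
have c0 : c = 0.
  apply: (simple c (X v)); rewrite -x1E -[X in Y *m X]opprK -u1E mulmxN.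
  by apply/eqP; rewrite -oppr_eq0 opprB WYu.
have x10 : X v1 = 0 by rewrite x1E c0; apply/colP => i; rewrite !mxE.
apply: v0 => //.
have [_ [d u1d]] : bform (shunt_mx G) (dsubmx v1) (dsubmx v1) = 0 /\
    exists d, dsubmx v1 = const_mx d.
  by apply: conductance_mul_eq0 => //; move: WYu; rewrite x10 mulmx0 subr0.
have LxE i : (L *m X v) i 0 = - d / beta 0 i.
  move: u1E; rewrite u1d -mulmxA => /colP/(_ i).
  rewrite mul_diag_mx !mxE => ->; field.
  by rewrite gt_eqF.
(* The entries of L x sum to 0, whereas they equal - d / beta_i with every beta_i positive; hence d
   = 0. *)
have : bform L (const_mx 1) (X v) = 0.
  rewrite bform_symC ?LE ?branch_mx_sym //.
  by rewrite /bform -mulmxA branch_mul_const mulmx0 mxE.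
rewrite bformE; under eq_bigr do rewrite LxE mxE mul1r.
rewrite -mulr_sumr => /eqP; rewrite mulf_eq0 oppr_eq0 => /orP[/eqP d0|].
  by rewrite u1d d0; apply/colP => i; rewrite !mxE.
rewrite gt_eqF // (bigD1 ord0) //= ltr_pwDl ?invr_gt0 //.
by apply: sumr_ge0 => i _; rewrite invr_ge0 ltW.
Qed.

End Reduction.

(** * Verification of the conditions c1 and c2 *)

Lemma max_entry_ge (R : realType) n (v : 'rV[R]_n) i : v 0 i <= max_entry v.
Proof. exact: (le_bigmax 0 (fun i => v 0 i)). Qed.

Lemma bform_eq0 (R : realType) n (M M' K K' : 'M[R]_n) (x y2 y1 y0 : 'cV[R]_n) :
  M *m y2 + M' *m y1 + (K *m y0 + K' *m y1) = 0 ->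
  bform M x y2 + bform M' x y1 + (bform K x y0 + bform K' x y1) = 0.
Proof.
move=> /(congr1 (mulmx x^T))/(congr1 (fun N : 'M[R]_1 => N 0 0)).
have add (P Q : 'M[R]_1) : (P + Q) 0 0 = P 0 0 + Q 0 0 by rewrite mxE.
by rewrite !mulmxDr !mulmxA mulmx0 !add => ->; rewrite mxE.
Qed.

(** At z = - p / (q + 1) the polynomial equals - (p / (q + 1))^2; the shift by 1 keeps the
    denominator positive when q = 0. *)
Lemma linear_coef_eq0 (R : realFieldType) (p q : R) : 0 <= q ->
  (forall z, 0 <= z * p + z ^+ 2 * q) -> p = 0.
Proof.
move=> q0 /(_ (- p / (q + 1))) h; apply/eqP; rewrite -sqrf_eq0 eq_le sqr_ge0 andbT.
have q1 : 0 < q + 1 by rewrite ltr_wpDl.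
have : 0 <= - (p ^+ 2 / (q + 1) ^+ 2).
  suff <- : - p / (q + 1) * p + (- p / (q + 1)) ^+ 2 * q = - (p ^+ 2 / (q + 1) ^+ 2) by [].
  by field; rewrite gt_eqF.
by rewrite oppr_ge0 pmulr_lle0 // invr_gt0 exprn_gt0.
Qed.

(** For a possibly non-symmetric M with nonnegative form, a right null vector is also a left one: on
    y + z x the form is z M(y, x) + z^2 M(x, x), whose linear coefficient must vanish. *)
Lemma bform_psd_kernel (R : realType) n (M : 'M[R]_n) (x y : 'cV[R]_n) :
  (forall z, 0 <= bform M z z) -> M *m y = 0 -> bform M y x = 0.
Proof.
move=> M_ge0 My; apply: (@linear_coef_eq0 R _ (bform M x x)) => // z.
have right0 v : bform M v y = 0 by rewrite /bform -mulmxA My mulmx0 mxE.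
have := M_ge0 (y + z *: x).
rewrite bformDr bformZr right0 add0r.
rewrite -[bform M (y + _) x]bform_tr bformDr bformZr !bform_tr.
by rewrite mulrDr mulrA -expr2.
Qed.

Section Conditions.
Context {R : realType} {n' : nat}.
Local Notation n := n'.+1.
Variable G : 'M[R]_n.
Hypothesis HG : conductances G.
Variables tau r Imax alpha beta : 'rV[R]_n.
Hypotheses (tau_gt0 : forall i, 0 < tau 0 i) (r_gt0 : forall i, 0 < r 0 i)
  (Imax_gt0 : forall i, 0 < Imax 0 i) (beta_gt0 : forall i, 0 < beta 0 i)
  (conn : connected_network G).

Let Y := conductance_mx G.
Let L := info_laplacian Y.
Let D := diag_mx tau.
Let Rv := diag_mx r.
Let Ups := diag_mx Imax.
Let Phi := diag_mx alpha.
Let Psi := diag_mx beta.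

Let LE : L = branch_mx (info_weights G) := info_laplacianE G.
Let L_const c : L *m const_mx c = 0 :> 'cV[R]_n.
Proof. by rewrite LE branch_mul_const. Qed.
Let L_sym : L^T = L.
Proof. by rewrite LE (branch_mx_sym (conductances_info HG)). Qed.
Let Ups_sym : Ups^T = Ups. Proof. exact: tr_diag_mx. Qed.
Let DUps_sym : (D *m Ups)^T = D *m Ups.
Proof. by rewrite mulmx_diag tr_diag_mx. Qed.

Let one : 'cV[R]_n := const_mx 1.
Let one_neq0 : one != 0.
Proof. by apply/eqP => /colP/(_ ord0); rewrite !mxE => /eqP; rewrite oner_eq0. Qed.

Let pair_gt0 (v : 'rV[R]_n) (a b : 'cV[R]_n) : (forall i, 0 < v 0 i) ->
  (a != 0) || (b != 0) -> 0 < bform (diag_mx v) a a + bform (diag_mx v) b b.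
Proof.
move=> v_gt0.
have ge0 x : 0 <= bform (diag_mx v) x x.
  by rewrite bform_diagE sumr_ge0 // => i _; rewrite mulr_ge0 ?sqr_ge0 // ltW.
case/orP => nz; first by rewrite ltr_pwDl // bform_diag_gt0.
by rewrite ltr_wpDl // bform_diag_gt0.
Qed.

Lemma semistable_c1 (ubar rbar nu1 : R) : 0 < ubar -> 0 < rbar -> 0 < nu1 ->
  (forall i, r 0 i * Imax 0 i = ubar /\ alpha 0 i = beta 0 i * rbar) ->
  mxge (Ups + ubar *: Y) (nu1 *: (Y *m Psi *m L)) ->
  theta_exists (Y *m Psi *m L) ->
  ((max_entry tau)%:E <
     (nu1 + rbar)%:E * theta (Y *m Psi *m L) ^+ 2 + rbar%:E)%E ->
  semistable (system_mx Y L D Rv Ups Phi Psi).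
Proof.
move=> ubar_gt0 rbar_gt0 nu1_gt0 params damp th_ex th.
set K := Y *m Psi *m L in damp th_ex th.
have [t Kt Tlt] := theta_set_witness (addr_gt0 nu1_gt0 rbar_gt0) th_ex th.
have WE : Ups + Y *m Rv *m Ups = Ups + ubar *: Y.
  rewrite -mulmxA mulmx_diag; congr (_ + _).
  have -> : diag_mx (\row_i (r 0 i * Imax 0 i)) = ubar%:M.
    by apply/matrixP => i j; rewrite !mxE (params _).1.
  by rewrite mul_mx_scalar.
have PhiE : Phi = rbar *: Psi.
  by apply/matrixP => i j; rewrite !mxE (params _).2 mulrnAr mulrC.
have W_sym : (Ups + ubar *: Y)^T = Ups + ubar *: Y.
  by rewrite linearD linearZ /= Ups_sym /Y conductance_mx_sym.
have KE (x x1 : 'cV[R]_n) :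
    Y *m (Psi *m L *m x + Phi *m L *m x1) = K *m x + (rbar *: K) *m x1.
  by rewrite PhiE mulmxDr !mulmxA -!scalemxAr -!scalemxAl.
have Y_ge0 x : 0 <= bform Y x x by exact: bform_conductance_ge0.
apply: system_semistable => // [s w a b a1 b1|c x].
  rewrite WE !KE => /[dup] ea ea' /[dup] eb eb' s_ge0 nz.
  (* With x = a + i b, pairing the real equation with a and the imaginary one with b and adding
     gives the real part of the pencil tested against x; the crossed pairings, subtracted, give the
     imaginary part. *)
  have {}ea := bform_eq0 a ea; have {}eb := bform_eq0 b eb.
  have {}ea' := bform_eq0 b ea'; have {}eb' := bform_eq0 a eb'.
  rewrite /a1 /b1 !(bformBr, bformDr, bformZr, bformZm _ K) -/D -/Ups in ea eb ea' eb'.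
  have Msym := bform_symC a b DUps_sym.
  have Wsym := bform_symC a b W_sym.
  have gE x : bform (Ups + ubar *: Y) x x = bform Ups x x + ubar * bform Y x x.
    by rewrite bformDm bformZm.
  have gge x : bform Ups x x <= bform (Ups + ubar *: Y) x x.
    by rewrite gE lerDl mulr_ge0 // ltW.
  have damp' x := mxge_bform x damp.
  have sector := theta_set_bound a b Kt.
  have mle x : bform (D *m Ups) x x <= max_entry tau * bform Ups x x.
    rewrite mulmx_diag !bform_diagE mulr_sumr; apply: ler_sum => i _.
    rewrite mxE mulrA ler_wpM2r ?sqr_ge0 // ler_wpM2r ?max_entry_ge //.
    exact: ltW.
  apply: (@sector_stiffness_stable R s w
    (bform (D *m Ups) a a + bform (D *m Ups) b b)
    (bform Ups a a + bform Ups b b)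
    (bform (Ups + ubar *: Y) a a + bform (Ups + ubar *: Y) b b)
    (bform K a a + bform K b b) (bform K a b - bform K b a)
    rbar nu1 t (max_entry tau)) => //.
  - exact: theta_set_ge0 Kt.
  - rewrite mulmx_diag; apply: pair_gt0 => // i.
    by rewrite mxE mulr_gt0.
  - exact: pair_gt0.
  - by rewrite lerD.
  - by rewrite mulrDr lerD // -bformZm.
  - by rewrite mulrDr lerD.
  - have := congr2 +%R ea eb; rewrite addr0 => <-; rewrite Msym Wsym; ring.
  - have := congr2 (fun p q => p - q) eb' ea'; rewrite subr0 => <-.
    by rewrite Msym Wsym; ring.
rewrite WE => e.
have K_ge0 (v : 'cV[R]_n) : 0 <= bform K v v.
  have := theta_set_bound v v Kt.
  by rewrite subrr normr0 mulr0 -mulr2n pmulrn_lge0.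
(* K kills the vector 1 on the right, hence also on the left; testing with 1 leaves c times a
   positive number. *)
have K1 : bform K one x = 0.
  by apply: bform_psd_kernel => //; rewrite /K -mulmxA L_const mulmx0.
have := @bform_eq0 R n (Ups + ubar *: Y) 0 K 0 one (const_mx c) 0 x.
rewrite !mulmx0 !addr0 /K -[Y *m Psi *m L *m x]mulmxA -[Y *m Psi *m _]mulmxA.
rewrite (mulmxA Psi) -/K => /(_ e); rewrite K1.
have -> : const_mx c = c *: one by apply/colP => i; rewrite !mxE mulr1.
have z0 (M : 'M[R]_n) : bform M one 0 = 0 by rewrite /bform mulmx0 mxE.
rewrite !z0 !addr0 bformZr => /eqP; rewrite mulf_eq0 => /orP[/eqP //|].
rewrite gt_eqF // bformDm bformZm ltr_pwDl ?bform_diag_gt0 //.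
by rewrite mulr_ge0 // ltW.
Qed.

Lemma semistable_c2 (tau0 rbar beta0 nu2 : R) :
  0 < tau0 -> 0 < rbar -> 0 < beta0 -> 0 < nu2 ->
  D = tau0 *: 1%:M -> Phi = rbar *: Psi -> Psi = beta0 *: 1%:M ->
  shunt_mx G != 0 ->
  mxge (invmx Y *m Ups + Rv *m Ups) ((nu2 * beta0) *: L) ->
  theta_exists (Y *m Ups) ->
  (tau0%:E <
     (nu2 + rbar)%:E * theta (Y *m Ups) ^+ 2 + (nu2 + rbar)%:E)%E ->
  semistable (system_mx Y L D Rv Ups Phi Psi).
Proof.
move=> tau0_gt0 rbar_gt0 beta0_gt0 nu2_gt0 DE PhiE PsiE shunt_neq0 damp th_ex th.
have nr_gt0 : 0 < nu2 + rbar by rewrite addr_gt0.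
have [t Qt Tlt] := theta_set_witness nr_gt0 th_ex th.
have Y_sym : Y^T = Y by exact: conductance_mx_sym.
have Y_unit : Y \in unitmx by exact: conductance_mx_unit.
set P := invmx Y *m Ups in damp; set RU := Rv *m Ups in damp.
(* P = Y^-1 (Y Upsilon)^T Y^-1 is congruent to the transpose of Y Upsilon, so the sector of Y
   Upsilon passes to P; the transposition only changes the sign of the imaginary part. *)
have P_form (x y : 'cV[R]_n) :
    bform P x y = bform (Y *m Ups) (invmx Y *m y) (invmx Y *m x).
  have PT : P^T = Ups *m invmx Y by rewrite trmx_mul Ups_sym trmx_inv Y_sym.
  by rewrite -bform_tr PT /bform trmx_mul trmx_inv Y_sym !mulmxA mulmxKV.
have sector (x y : 'cV[R]_n) :
    t * `|bform P x y - bform P y x| <= bform P x x + bform P y y.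
  have := theta_set_bound (invmx Y *m y) (invmx Y *m x) Qt.
  by rewrite -!P_form [X in _ <= X]addrC.
have RU_gt0 (x : 'cV[R]_n) : x != 0 -> 0 < bform RU x x.
  by move=> x0; rewrite /RU mulmx_diag bform_diag_gt0 // => i; rewrite mxE mulr_gt0.
have RU_sym : RU^T = RU by rewrite /RU mulmx_diag tr_diag_mx.
have P_ge0 (x : 'cV[R]_n) : 0 <= bform P x x.
  have := sector x x.
  by rewrite subrr normr0 mulr0 -mulr2n pmulrn_lge0.
(* After multiplication by Y^-1 the matrices R Upsilon and L are symmetric, and P alone contributes
   an imaginary part. *)
have cancelY (x2 x1 x0 : 'cV[R]_n) :
    D *m Ups *m x2 + (Ups + Y *m Rv *m Ups) *m x1
      + Y *m (Psi *m L *m x0 + Phi *m L *m x1) = 0 ->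
    (tau0 *: P) *m x2 + (P + RU) *m x1
      + ((beta0 *: L) *m x0 + (rbar *: (beta0 *: L)) *m x1) = 0.
  move=> /(congr1 (mulmx (invmx Y))); rewrite mulmx0 => <-.
  rewrite !mulmxDr mulKmx // mulKmx //; congr (_ + _ + _).
  - by rewrite DE -!scalemxAl mul1mx -scalemxAr mulmxA.
  - by rewrite mulmxA mulmxDr -[Y *m Rv *m Ups]mulmxA mulKmx.
  - by rewrite PhiE PsiE -!scalemxAl !mul1mx.
apply: system_semistable => // [s w a b a1 b1|c x].
  move=> /cancelY ea' /cancelY eb' s_ge0 nz.
  have ea := bform_eq0 a ea'; have eb := bform_eq0 b eb'.
  have {}ea' := bform_eq0 b ea'; have {}eb' := bform_eq0 a eb'.
  rewrite /a1 /b1 !(bformBr, bformDr, bformZr, bformDm, bformZm) in ea eb ea' eb'.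
  have RUsym := bform_symC a b RU_sym.
  have Lsym := bform_symC a b L_sym.
  have dampE x := mxge_bform x damp.
  apply: (@sector_inertia_stable R s w (bform P a a + bform P b b)
    (bform P a b - bform P b a) (bform RU a a + bform RU b b)
    (beta0 * (bform L a a + bform L b b)) rbar nu2 t tau0) => //.
  - exact: theta_set_ge0 Qt.
  - by rewrite /RU mulmx_diag; apply: pair_gt0 => // i; rewrite mxE mulr_gt0.
  - rewrite mulr_ge0 ?(ltW beta0_gt0) // LE.
    by rewrite addr_ge0 // (bform_branch_ge0 (conductances_info HG)).
  - have := dampE a; have := dampE b; rewrite !bformZm !bformDm; lra.
  - have := congr2 +%R ea eb; rewrite addr0 => <-; rewrite RUsym Lsym; ring.
  - have := congr2 (fun p q => p - q) eb' ea'; rewrite subr0 => <-.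
    by rewrite RUsym Lsym; ring.
move=> e.
(* Testing with 1 removes L, which is symmetric and kills 1, and leaves c times the positive value
   of P + R Upsilon at 1. *)
have /cancelY/(@bform_eq0 _ _ _ _ _ _ one) : D *m Ups *m 0
    + (Ups + Y *m Rv *m Ups) *m const_mx c
    + Y *m (Psi *m L *m x + Phi *m L *m const_mx c) = 0.
  by rewrite mulmx0 add0r -[Phi *m L *m _]mulmxA L_const mulmx0 addr0; exact: e.
have L1 (y : 'cV[R]_n) : bform L y one = 0.
  by rewrite /bform -mulmxA L_const mulmx0 mxE.
have -> : const_mx c = c *: one by apply/colP => i; rewrite !mxE mulr1.
have -> : bform (tau0 *: P) one 0 = 0 by rewrite /bform mulmx0 mxE.
rewrite !bformZm !bformZr L1 (bform_symC _ _ L_sym) L1 !mulr0 !addr0 add0r.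
move=> /eqP; rewrite mulf_eq0 => /orP[/eqP //|].
by rewrite gt_eqF // bformDm ltr_wpDl ?RU_gt0.
Qed.

End Conditions.

Theorem theorem1 (R : realType) (n : nat) (n_gt0 : (0 < n)%N)
    (G : 'M[R]_n) (HG : conductances G)
    (tau r Imax alpha beta : 'rV[R]_n)
    (tau_gt0 : forall i, 0 < tau 0 i) (r_gt0 : forall i, 0 < r 0 i)
    (Imax_gt0 : forall i, 0 < Imax 0 i)
    (alpha_gt0 : forall i, 0 < alpha 0 i)
    (beta_gt0 : forall i, 0 < beta 0 i) :
  let Y := conductance_mx G in
  let L := info_laplacian Y in
  let D := diag_mx tau in
  let Rv := diag_mx r in
  let Ups := diag_mx Imax in
  let Phi := diag_mx alpha in
  let Psi := diag_mx beta in
  let c1 :=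
    exists ubar rbar nu1 : R,
      [/\ 0 < ubar, 0 < rbar & 0 < nu1] /\
      [/\ forall i, r 0 i * Imax 0 i = ubar /\ alpha 0 i = beta 0 i * rbar,
          mxge (Ups + ubar *: Y) (nu1 *: (Y *m Psi *m L)),
          theta_exists (Y *m Psi *m L) &
          ((max_entry tau)%:E <
            (nu1 + rbar)%:E * theta (Y *m Psi *m L) ^+ 2 + rbar%:E)%E] in
  let c2 :=
    exists tau0 rbar beta0 nu2 : R,
      [/\ 0 < tau0, 0 < rbar, 0 < beta0 & 0 < nu2] /\
      [/\ D = tau0 *: 1%:M, Phi = rbar *: Psi & Psi = beta0 *: 1%:M] /\
      [/\ mxge (shunt_mx G) 0 /\ shunt_mx G != 0,
          mxge (invmx Y *m Ups + Rv *m Ups) ((nu2 * beta0) *: L),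
          theta_exists (Y *m Ups) &
          (tau0%:E <
            (nu2 + rbar)%:E * theta (Y *m Ups) ^+ 2 + (nu2 + rbar)%:E)%E] in
  connected_network G ->
  c1 \/ c2 ->
  semistable (system_mx Y L D Rv Ups Phi Psi).
Proof.
case: n n_gt0 G HG tau r Imax alpha beta tau_gt0 r_gt0 Imax_gt0 alpha_gt0 beta_gt0
  => // n' _ G HG tau r Imax alpha beta tau_gt0 r_gt0 Imax_gt0 _ beta_gt0.
move=> Y L D Rv Ups Phi Psi c1 c2 conn [].
  case=> ubar [rbar [nu1 [[ubar0 rbar0 nu10] [params damp th_ex th]]]].
  exact: (@semistable_c1 _ _ _ HG _ _ _ _ _ _ _ _ _ ubar rbar nu1).
case=> tau0 [rbar [beta0 [nu2 [[tau00 rbar0 beta00 nu20] [[DE PhiE PsiE]]]]]].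
case=> [[_ shunt0] damp th_ex th].
exact: (@semistable_c2 _ _ _ HG _ _ _ _ _ _ _ _ _ _ tau0 rbar beta0 nu2).
Qed.
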